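(* For all integers $n\ge 1$, $r\ge 2$, $s\ge 1$, $\chi_{la}\big(r((2s)P_2\vee O_{2n})\big)=3$.
   Context: For a graph $G$ with $q$ edges, a local antimagic labeling is a bijection $f:E(G)\to\{1,\dots,q\}$ such that, writing $f^+(u)=\sum_{e\ni u}f(e)$, we have $f^+(u)\ne f^+(v)$ for every edge $uv$. $\chi_{la}(G)$ is the minimum over all local antimagic labelings of the number of distinct values of $f^+$. $aP_2$ is the disjoint union of $a$ copies of the one-edge path $P_2$, $O_m$ is the edgeless graph on $m$ vertices, $\vee$ denotes the join, and $rH$ denotes the disjoint union of $r$ copies of $H$. *)

(* Defs.v *)
From mathcomp Require Import all_boot.

Set Implicit Arguments.
Unset Strict Implicit.
Unset Printing Implicit Defensive.

Record sgraph := SGraph {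
  vertex :> finType;
  adj : rel vertex;
  adj_sym : symmetric adj;
  adj_irrefl : irreflexive adj
}.

Definition path_adj (m : nat) : rel 'I_m :=
  fun i j => (i.+1 == j :> nat) || (j.+1 == i :> nat).

Lemma path_adj_sym m : symmetric (@path_adj m).
Proof. by move=> i j; rewrite /path_adj orbC. Qed.

Lemma path_adj_irrefl m : irreflexive (@path_adj m).
Proof. by move=> i; rewrite /path_adj orbb gtn_eqF. Qed.

(* P_m has m vertices, hence m - 1 edges. *)
Definition path_graph (m : nat) : sgraph :=
  SGraph (@path_adj_sym m) (@path_adj_irrefl m).

Definition edgeless_adj (m : nat) : rel 'I_m := fun _ _ => false.

Lemma edgeless_adj_sym m : symmetric (@edgeless_adj m).
Proof. by []. Qed.

Lemma edgeless_adj_irrefl m : irreflexive (@edgeless_adj m).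
Proof. by []. Qed.

Definition edgeless_graph (m : nat) : sgraph :=
  SGraph (@edgeless_adj_sym m) (@edgeless_adj_irrefl m).

Definition copies_adj (r : nat) (H : sgraph) : rel ('I_r * H)%type :=
  fun u v => (u.1 == v.1) && adj u.2 v.2.

Lemma copies_adj_sym r H : symmetric (@copies_adj r H).
Proof. by move=> u v; rewrite /copies_adj eq_sym adj_sym. Qed.

Lemma copies_adj_irrefl r H : irreflexive (@copies_adj r H).
Proof. by move=> u; rewrite /copies_adj adj_irrefl andbF. Qed.

Definition copies (r : nat) (H : sgraph) : sgraph :=
  SGraph (@copies_adj_sym r H) (@copies_adj_irrefl r H).

Definition join_adj (G H : sgraph) : rel (G + H)%type :=
  fun u v =>
    match u, v with
    | inl x, inl y => adj x y
    | inr x, inr y => adj x y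
    | _, _ => true
    end.

Lemma join_adj_sym G H : symmetric (@join_adj G H).
Proof. by move=> [x|x] [y|y] //=; rewrite adj_sym. Qed.

Lemma join_adj_irrefl G H : irreflexive (@join_adj G H).
Proof. by move=> [x|x] /=; rewrite adj_irrefl. Qed.

Definition join_graph (G H : sgraph) : sgraph :=
  SGraph (@join_adj_sym G H) (@join_adj_irrefl G H).

Section LocalAntimagic.
Variable G : sgraph.

Definition edge_set : {set {set G}} :=
  [set [set p.1; p.2] | p : G * G & adj p.1 p.2].

Definition edge : finType := {e : {set G} | e \in edge_set}.

(* The label set {1, .., q} is represented by 'I_q, with i : 'I_q standing
   for the label i.+1. *)
Definition edge_labeling : finType := {ffun edge -> 'I_#|edge_set|}.

Definition label (f : edge_labeling) (e : edge) : nat := (f e).+1.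

Definition bijective_labeling (f : edge_labeling) : bool :=
  injectiveb f && [forall k, exists e, f e == k].

Definition induced_label (f : edge_labeling) (u : G) : nat :=
  \sum_(e : edge | u \in val e) label f e.

Definition local_antimagic (f : edge_labeling) : bool :=
  bijective_labeling f &&
  [forall u : G, forall v : G,
     adj u v ==> (induced_label f u != induced_label f v)].

Definition num_colors (f : edge_labeling) : nat :=
  size (undup [seq induced_label f u | u : G]).

(* The value is 0 when G has no local antimagic labeling; otherwise it is
   positive as soon as G has a vertex. *)
Definition chi_la : nat :=
  if [pick f | local_antimagic f] is Some f0
  then num_colors [arg min_(f < f0 | local_antimagic f) num_colors f]
  else 0.

End LocalAntimagic.

(* Main.v *)
(** The graph contains triangles, so at least three colors are needed.  For a
    labeling with three colors, let t = rs, N = t(4n+1), so that there are 2N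
    edges and complementary labels add up to 2N+1.  Pair the 2s copies of P_2
    inside each copy of the join; the second column of a pair carries the
    complements of the labels of the first one, with the two endpoints of P_2
    exchanged.  Then every vertex of O_{2n} has the same sum 2s(2N+1), and it
    remains to label t columns (one per pair) of 4n+1 edges with one label out
    of each complementary pair, such that the two endpoint sums A and B do not
    depend on the column and 2A + d = (2n+1)(2N+1) = 2B - d with d < 2N+1:
    parity then gives d > 0 and A <> B, and the bound on d separates both from
    2s(2N+1).  A label is encoded as a magnitude k < N and a sign, for the
    label N+1+k or N-k, i.e. for the signed odd number +-(2k+1).  The case
    n = 1 is an explicit table of 5 rows, of magic rectangle type; larger n
    only appends quadruples of rows in arithmetic progression. *)

Require Import Defs.
From mathcomp Require Import all_boot zify.

Set Implicit Arguments.
Unset Strict Implicit.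
Unset Printing Implicit Defensive.

(** * Signed labels and the tables with five rows *)

(** Zero-based, like the labels in ['I_q]: the successor is the actual label [N+1+k] or [N-k]. *)
Definition slab (N : nat) (b : bool) (k : nat) : nat :=
  if b then N + k else N - k.+1.

(* Row 0 is the P_2 edge, rows 1, 2 belong to one endpoint and rows 3, 4 to the
   other.  The permutation x of the columns is chosen so that c + x - m is again
   a permutation; this needs the number of columns 2m+1 to be odd. *)
Definition odd_mag (m rho c : nat) : nat :=
  let t := m.*2.+1 in
  let x := (if odd c then m.*2 else m) - c./2 in
  let y := (if odd c then m.+1 else 0) + c./2 in
  match rho with
  | 0 => t + c
  | 1 => x
  | 2 => 2 * t + y
  | 3 => 3 * t + x
  | _ => 4 * t + y
  end.

Definition odd_sgn (rho : nat) : bool := rho \in [:: 0; 1; 3].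

(* No such permutation exists for 2m columns.  Instead, all rows have slope +-1
   in c on each half of the columns, except for one row at each endpoint, rows 2
   and 4, whose slope is +-2: these take the magnitudes [2m, 4m) and [0, 2m), the
   even ones on the first half of the columns, the odd ones on the second. *)
Definition even_mag (m rho c : nat) : nat :=
  if c < m then
    match rho with
    | 0 => 6 * m + c
    | 1 => 10 * m - c.+1
    | 2 => 4 * m - 2 * c.+1
    | 3 => 6 * m - c.+1
    | _ => 2 * c
    end
  else let c := c - m in
    match rho with
    | 0 => 7 * m + c
    | 1 => 5 * m - c.+1
    | 2 => 2 * m + 2 * c + 1
    | 3 => 9 * m - c.+1
    | _ => 2 * m - 2 * c - 1
    end.

Definition even_sgn (m rho c : nat) : bool :=
  if c < m then rho \in [:: 0; 2] else rho \in [:: 0; 4].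

(** [N] is only bounded below, so that the same five rows can serve as the middle labels of a longer
    table. *)
Definition base_spec (t : nat) (M : nat -> nat -> nat)
    (S : nat -> nat -> bool) (d : nat) : Prop :=
  [/\ forall rho c, rho < 5 -> c < t -> M rho c < 5 * t,
      forall rho c rho' c', rho < 5 -> c < t -> rho' < 5 -> c' < t ->
        M rho c = M rho' c' -> rho = rho' /\ c = c'
    & forall N c, 5 * t <= N -> c < t ->
        let L rho := (slab N (S rho c) (M rho c)).+1 in
        2 * (L 0 + L 1 + L 2) + d = 3 * (2 * N).+1 /\
        2 * (L 0 + L 3 + L 4) = 3 * (2 * N).+1 + d].

(** Since [y = c + x - m], rows 0, 1, 2 sum to [3N+2-t+m] and rows 0, 3, 4 to [3N+2+m], whence
    [d = 2m+1]. *)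
Lemma odd_base m : base_spec m.*2.+1 (odd_mag m) (fun rho _ => odd_sgn rho) m.*2.+1.
Proof.
split.
- case=> [|[|[|[|[|rho]]]]] c // _; rewrite /odd_mag; have := odd_double_half c; case: (odd c); lia.
- move=> rho c rho' c' Hr Hc Hr' Hc'.
  have E := odd_double_half c; have E' := odd_double_half c'.
  case: rho Hr => [|[|[|[|[|rho]]]]] // _; case: rho' Hr' => [|[|[|[|[|rho']]]]] // _;
  rewrite /odd_mag; move: E E'; case: (odd c); case: (odd c'); lia.
- move=> N c HN Hc /=; rewrite /slab /odd_sgn /odd_mag /=.
  have := odd_double_half c; case: (odd c); lia.
Qed.

(** On each half the slopes cancel, leaving the sums [3N+1] and [3N+2]. *)
Lemma even_base m : base_spec m.*2 (even_mag m) (even_sgn m) 1.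
Proof.
split.
- case=> [|[|[|[|[|rho]]]]] c // _; rewrite /even_mag; case: ifP; lia.
- move=> rho c rho' c' Hr Hc Hr' Hc'.
  case: rho Hr => [|[|[|[|[|rho]]]]] // _; case: rho' Hr' => [|[|[|[|[|rho']]]]] // _;
  rewrite /even_mag; case: ifP; case: ifP; lia.
- move=> N c HN Hc /=; rewrite /slab /even_sgn /even_mag.
  by case: (ltnP c m) => Hcm /=; lia.
Qed.

Lemma exists_base t : 0 < t -> exists M S d, base_spec t M S d /\ d <= t.
Proof.
move=> t_gt0; rewrite -(odd_double_half t); set m := t./2.
case: (odd t) (odd_double_half t) => /= E.
  by do 3 eexists; split; first exact: odd_base.
do 3 eexists; split; first exact: even_base; lia.
Qed.

(** * Extension to [4n+1] rows *)

Definition ext_mag (t : nat) (M : nat -> nat -> nat) (rho c : nat) : nat :=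
  if rho < 5 then M rho c else t * rho + c.

(* Rows 4l+1, 4l+2 have signs +, - and go to the first endpoint, rows 4l+3, 4l+4
   have signs -, + and go to the second one. *)
Definition ext_sgn (S : nat -> nat -> bool) (rho c : nat) : bool :=
  if rho < 5 then S rho c else rho %% 4 < 2.

Definition table_spec (n t : nat) (M : nat -> nat -> nat)
    (S : nat -> nat -> bool) (d : nat) : Prop :=
  let N := t * (4 * n).+1 in
  [/\ forall rho c, rho < (4 * n).+1 -> c < t -> M rho c < N,
      forall rho c rho' c', rho < (4 * n).+1 -> c < t ->
        rho' < (4 * n).+1 -> c' < t ->
        M rho c = M rho' c' -> rho = rho' /\ c = c'
    & forall c, c < t ->
        let L rho := (slab N (S rho c) (M rho c)).+1 in
        2 * (L 0 + \sum_(l < n) (L (4 * l + 1) + L (4 * l + 2))) + d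
          = (2 * n + 1) * (2 * N).+1 /\
        2 * (L 0 + \sum_(l < n) (L (4 * l + 3) + L (4 * l + 4)))
          = (2 * n + 1) * (2 * N).+1 + d].

Lemma exists_table n t : 0 < n -> 0 < t ->
  exists M S d, table_spec n t M S d /\ d < (2 * (t * (4 * n).+1)).+1.
Proof.
case: n => // n _ t_gt0.
have [M [S [d [[Mlt Minj Msum] dt]]]] := exists_base t_gt0.
(* Each of the [n] appended quadruples adds [2N+1-t] to the first endpoint and [2N+1+t] to the
   second, so the doubled sums move by [2t]. *)
exists (ext_mag t M), (ext_sgn S), (d + 2 * n * t); split; last by nia.
rewrite /table_spec; set N := t * _; have N5 : 5 * t <= N by rewrite /N; nia.
split.
- move=> rho c Hr Hc; rewrite /ext_mag.
  case: ifP => Hr5; first exact: leq_trans (Mlt _ _ Hr5 Hc) N5.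
  rewrite -/N /N; nia.
- move=> rho c rho' c' Hr Hc Hr' Hc'; rewrite /ext_mag.
  case: ifP => Hr5; case: ifP => Hr5' E.
  + exact: (Minj rho c rho' c').
  + have := Mlt _ _ Hr5 Hc; nia.
  + have := Mlt _ _ Hr5' Hc'; nia.
  + have Er : rho = rho'.
      have := congr1 (divn^~ t) E; rewrite /= !(mulnC t) !divnMDl //.
      by rewrite !divn_small // !addn0.
    by split=> //; move: E; rewrite Er => /addnI.
- move=> c Hc /=; have [Hu Hv] := Msum N c N5 Hc.
  rewrite -/N !big_ord_recl /=.
  set SU := \sum_(i < n) _; set SV := \sum_(i < n) _.
  have magE q : 5 <= q -> ext_mag t M q c = t * q + c.
    by rewrite ltnNge => /negPf q5; rewrite /ext_mag ltnS q5.
  have sgnE q : 5 <= q -> ext_sgn S q c = (q %% 4 < 2).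
    by rewrite ltnNge => /negPf q5; rewrite /ext_sgn ltnS q5.
  have ext_lt q : 5 <= q -> q < (4 * n.+1).+1 -> t * q + c < N.
    by rewrite /N => *; nia.
  have EU : SU + n * t = n * (2 * N).+1.
    rewrite -[n in RHS]card_ord -[n in n * t]card_ord -!sum_nat_const -big_split /=.
    apply: eq_bigr => i _; rewrite /bump /=.
    have Hi := ltn_ord i.
    have E1 : (4 * (1 + i) + 1) %% 4 = 1 by lia.
    have E2 : (4 * (1 + i) + 2) %% 4 = 2 by lia.
    rewrite !magE ?sgnE; try lia; rewrite E1 E2 /slab /=.
    have := @ext_lt (4 * (1 + i) + 1); have := @ext_lt (4 * (1 + i) + 2).
    rewrite !mulnDr; lia.
  have EV : SV = n * (2 * N).+1 + n * t.
    rewrite -[n in n * _.+1]card_ord -[n in n * t]card_ord -!sum_nat_const -big_split /=.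
    apply: eq_bigr => i _; rewrite /bump /=.
    have Hi := ltn_ord i.
    have E1 : (4 * (1 + i) + 3) %% 4 = 3 by lia.
    have E2 : (4 * (1 + i) + 4) %% 4 = 0 by lia.
    rewrite !magE ?sgnE; try lia; rewrite E1 E2 /slab /=.
    have := @ext_lt (4 * (1 + i) + 3); have := @ext_lt (4 * (1 + i) + 4).
    rewrite !mulnDr; lia.
  move: Hu Hv; rewrite /ext_mag /ext_sgn /= => Hu Hv.
  move: EU EV Hu Hv; move: SU SV => SU SV; clear; move: (slab _ _ _) (slab _ _ _) (slab _ _ _)
    (slab _ _ _) (slab _ _ _) => L0 L1 L2 L3 L4.
  split; nia.
Qed.

(** * Complementary labels and auxiliary sums *)

Lemma slabK N b k : k < N -> (slab N (~~ b) k).+1 + (slab N b k).+1 = (2 * N).+1.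
Proof. by rewrite /slab; case: b => /=; lia. Qed.

Lemma slab_lt N b k : k < N -> slab N b k < 2 * N.
Proof. by rewrite /slab; case: b; lia. Qed.

Lemma slab_inj N b k b' k' : k < N -> k' < N ->
  slab N b k = slab N b' k' -> b = b' /\ k = k'.
Proof. by rewrite /slab; case: b; case: b' => *; split=> //; lia. Qed.

Lemma sum_ord_double m (F : nat -> nat) :
  \sum_(i < 2 * m) F i = \sum_(l < m) (F (2 * l) + F (2 * l).+1).
Proof.
elim: m => [|m IH]; first by rewrite !big_ord0.
by rewrite mulnS !addSn add0n !big_ord_recr /= IH addnA.
Qed.

Lemma sum_option_pair (T U : finType) (F : option (T * U) -> nat) :
  \sum_o F o = F None + \sum_x \sum_y F (Some (x, y)).
Proof.
rewrite (bigD1 None) //=; congr (_ + _).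
rewrite (reindex_omap Some id) /=; last by case.
rewrite pair_bigA; apply: eq_big => [x|[x y] _ //]; by rewrite eqxx.
Qed.

Lemma cards3_undup (T : eqType) (s : seq T) a b c :
  a \in s -> b \in s -> c \in s -> a != b -> a != c -> b != c ->
  3 <= size (undup s).
Proof.
move=> sa sb sc ab ac bc.
apply: (@uniq_leq_size _ [:: a; b; c]).
  by rewrite /= !inE negb_or ab ac bc.
by move=> x; rewrite !inE mem_undup => /or3P[] /eqP->.
Qed.

(** * Reduction to a numbering of encoded edges *)

Section ChiLa.
Variable G : sgraph.

Lemma chi_la_eq3 (x y z : G) (f : edge_labeling G) :
  adj x y -> adj x z -> adj y z -> local_antimagic f -> num_colors f <= 3 ->
  chi_la G = 3.
Proof.
move=> xy xz yz fP f3.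
have lb (h : edge_labeling G) : local_antimagic h -> 3 <= num_colors h.
  case/andP=> _ /forallP hP.
  have neq u v : adj u v -> induced_label h u != induced_label h v.
    by have /forallP/(_ v)/implyP := hP u.
  have im u : induced_label h u \in [seq induced_label h u | u : G] by exact: image_f.
  exact: cards3_undup (im x) (im y) (im z) (neq _ _ xy) (neq _ _ xz) (neq _ _ yz).
(* The labeling [f] rules out the default value 0. *)
rewrite /chi_la; case: pickP => [f0 f0P|/(_ f)]; last by rewrite fP.
case: arg_minnP => // h hP hmin.
by apply/eqP; rewrite eqn_leq lb // (leq_trans (hmin f fP)).
Qed.

(** Replaces the subtype [edge G] by a concrete type [D] of codes; surjectivity onto the labels
    follows by counting. *)
Lemma edge_labeling_of (D : finType) (phi : D -> {set G}) (g : D -> nat) :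
  injective phi -> [set phi d | d : D] = edge_set G ->
  injective g -> (forall d, g d < #|D|) ->
  exists2 f : edge_labeling G, bijective_labeling f &
    forall u, induced_label f u = \sum_(d | u \in phi d) (g d).+1.
Proof.
move=> phi_inj phi_im g_inj g_lt.
have phiE d : phi d \in edge_set G by rewrite -phi_im imset_f.
pose psi d : edge G := Sub (phi d) (phiE d).
have psi_inj : injective psi by move=> d d' /(congr1 val) /phi_inj.
have card_E : #|edge_set G| = #|D| by rewrite -phi_im card_imset.
have card_edge : #|edge G| = #|D| by rewrite card_sig -card_E; apply: eq_card.
have [chi psiK chiK] : bijective psi by apply: inj_card_bij; rewrite ?card_edge.
have g_lt' d : g d < #|edge_set G| by rewrite card_E.
pose f : edge_labeling G := [ffun e => Ordinal (g_lt' (chi e))].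
have f_inj : injective f.
  by move=> e e'; rewrite !ffunE => /(congr1 val) /g_inj /(can_inj chiK).
exists f.
  apply/andP; split; first exact/injectiveP.
  apply/forallP => k; apply/existsP.
  have [h _ hK] : bijective f.
    by apply: inj_card_bij => //; rewrite card_ord card_E card_edge.
  by exists (h k); rewrite hK.
move=> u; rewrite /induced_label (reindex psi) /=; last first.
  by exists chi => x _; rewrite ?psiK ?chiK.
by apply: eq_bigr => d _; rewrite /label ffunE psiK.
Qed.

End ChiLa.

(** * Edges of the graph and sums over incident edges *)

Definition join_copies (n r s : nat) : sgraph :=
  copies r (join_graph (copies (2 * s) (path_graph 2)) (edgeless_graph (2 * n))).

Section Construction.
Variables n r s : nat.

Let V := join_copies n r s.

(** Every edge meets exactly one copy of P_2: [None] is its own edge, [Some (b, j)] joins its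
    endpoint [b] to vertex [j] of O_{2n}. *)
Definition ecode : finType := ('I_r * 'I_(2 * s) * option ('I_2 * 'I_(2 * n)))%type.

Definition pvertex (k : 'I_r) (i : 'I_(2 * s)) (b : 'I_2) : V := (k, inl (i, b)).

Definition overtex (k : 'I_r) (j : 'I_(2 * n)) : V := (k, inr j).

Definition edge_of (d : ecode) : {set V} :=
  let: (k, i, o) := d in
  if o is Some (b, j) then [set pvertex k i b; overtex k j]
  else [set pvertex k i ord0; pvertex k i ord_max].

Lemma mem_pvertex k i b k' i' o :
  (pvertex k i b \in edge_of (k', i', o)) =
  [&& k' == k, i' == i & if o is Some (b', _) then b' == b else true].
Proof.
have E x y : (pvertex k i b == pvertex k' x y) = [&& k' == k, x == i & y == b].
  by apply/eqP/and3P => [[-> -> ->]|[/eqP-> /eqP-> /eqP->]].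
have E' j : (pvertex k i b == overtex k' j) = false by apply/eqP.
case: o => [[b' j]|] /=; rewrite !inE !E ?E' ?orbF //.
case: (k' == k) (i' == i) => [] [] //=.
by case: b {E E'} => [[|[|]]].
Qed.

Lemma mem_overtex k j k' i' o :
  (overtex k j \in edge_of (k', i', o)) =
  (k' == k) && (if o is Some (_, j') then j' == j else false).
Proof.
have E x y : (overtex k j == pvertex k' x y) = false by apply/eqP.
have E' x : (overtex k j == overtex k' x) = (k' == k) && (x == j).
  by apply/eqP/andP => [[-> ->]|[/eqP-> /eqP->]].
by case: o => [[b' j']|] /=; rewrite !inE !E ?E' ?andbF.
Qed.

(** An endpoint of P_2 on the edge determines [k] and [i]; testing further vertices for membership
    recovers [o]. *)
Lemma edge_of_inj : injective edge_of.
Proof.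
move=> [[k i] o] [[k' i'] o'] E.
have [b kb] : exists b, pvertex k i b \in edge_of (k, i, o).
  case: o E => [[b j] _|_]; [exists b | exists ord0];
  by rewrite mem_pvertex !eqxx.
have := kb; rewrite E mem_pvertex => /and3P[/eqP Ek /eqP Ei _].
move: E; rewrite {}Ek {}Ei => /setP E; congr (_, _, _).
case: o o' E {kb} => [[b1 j1]|] [[b2 j2]|] // E.
- have := E (pvertex k i b1); have := E (overtex k j1).
  rewrite !mem_pvertex !mem_overtex !eqxx /= => /esym/eqP-> /esym/eqP->.
  by [].
- by have := E (overtex k j1); rewrite !mem_overtex !eqxx.
- by have := E (overtex k j2); rewrite !mem_overtex !eqxx.
Qed.

Lemma edge_of_im : [set edge_of d | d : ecode] = edge_set V.
Proof.
apply/setP => e; apply/imsetP/imsetP.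
  case=> [[[k i] [[b j]|]]] _ ->.
    by exists (pvertex k i b, overtex k j); rewrite ?inE /= /copies_adj /= ?eqxx.
  exists (pvertex k i ord0, pvertex k i ord_max) => //.
  by rewrite inE /= /copies_adj /= /copies_adj /= !eqxx.
case=> [[[k u] [k' v]]]; rewrite inE /= /copies_adj /= => /andP[/eqP<-].
case: u v => [[i b]|j] [[i' b']|j'] //=.
- rewrite /copies_adj /= => /andP[/eqP<-] bb' ->.
  exists (k, i, None) => //=.
  case: b b' bb' => [[|[|//]] hb] [[|[|//]] hb'] //= _;
    [|rewrite setUC]; by congr [set _; _]; congr (_, inl (_, _)); apply: val_inj.
- by move=> _ ->; exists (k, i, Some (b, j')).
- by move=> _ ->; exists (k, i', Some (b', j)); rewrite //= setUC.
Qed.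

Arguments edge_of _ : simpl never.

Lemma sum_ecode (P : pred ecode) (F : ecode -> nat) :
  \sum_(d | P d) F d =
  \sum_k \sum_i \sum_o (if P (k, i, o) then F (k, i, o) else 0).
Proof.
rewrite big_mkcond pair_bigA pair_bigA /=.
by apply: eq_bigr => [[[k i] o]].
Qed.

Lemma sum_pvertex (F : ecode -> nat) k i b :
  \sum_(d | pvertex k i b \in edge_of d) F d =
  F (k, i, None) + \sum_j F (k, i, Some (b, j)).
Proof.
rewrite sum_ecode (bigD1 k) //= [X in _ + X]big1 ?addn0; last first.
  move=> k' /negPf kk'; rewrite big1 // => i' _; rewrite big1 // => o _.
  by rewrite mem_pvertex kk'.
rewrite (bigD1 i) //= [X in _ + X]big1 ?addn0; last first.
  move=> i' /negPf ii'; rewrite big1 // => o _.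
  by rewrite mem_pvertex ii' andbF.
rewrite sum_option_pair mem_pvertex !eqxx /=; congr (_ + _).
rewrite (bigD1 b) //= [X in _ + X]big1 ?addn0; last first.
  move=> b' /negPf bb'; rewrite big1 // => o _.
  by rewrite mem_pvertex bb' !andbF.
by apply: eq_bigr => j _; rewrite mem_pvertex !eqxx.
Qed.

Lemma sum_overtex (F : ecode -> nat) k j :
  \sum_(d | overtex k j \in edge_of d) F d =
  \sum_i (F (k, i, Some (ord0, j)) + F (k, i, Some (ord_max, j))).
Proof.
rewrite sum_ecode (bigD1 k) //= [X in _ + X]big1 ?addn0; last first.
  move=> k' /negPf kk'; rewrite big1 // => i' _; rewrite big1 // => o _.
  by rewrite mem_overtex kk'.
apply: eq_bigr => i _.
rewrite sum_option_pair mem_overtex andbF add0n.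
have E b : \sum_j' (if overtex k j \in edge_of (k, i, Some (b, j'))
    then F (k, i, Some (b, j')) else 0) = F (k, i, Some (b, j)).
  rewrite (bigD1 j) //= mem_overtex !eqxx big1 ?addn0 //.
  by move=> j' /negPf jj'; rewrite mem_overtex jj' andbF.
by rewrite !big_ord_recl big_ord0 addn0 !E; congr (_ + F (_, _, Some (_, _))); apply: val_inj.
Qed.

(** * The labeling read off the table *)

Variables (M : nat -> nat -> nat) (S : nat -> nat -> bool) (d0 : nat).
Hypothesis MS : table_spec n (r * s) M S d0.

Let N := r * s * (4 * n).+1.

(* h tells whether the column is the second one of its pair, in which case the
   endpoints b = 0 and b = 1 exchange their rows. *)
Definition row_of (h : bool) (b j : nat) : nat :=
  4 * j./2 + 2 * (h (+) (b == 1)) + odd j + 1.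

Definition code_row (h : bool) (o : option ('I_2 * 'I_(2 * n))) : nat :=
  if o is Some (b, j) then row_of h b j else 0.

Definition code_col (k i : nat) : nat := k * s + i./2.

(** Copies [2l] and [2l+1] of P_2 share a table column; adding [odd i] to the sign complements the
    labels of the second one. *)
Definition code_label (d : ecode) : nat :=
  let: (k, i, o) := d in
  let rho := code_row (odd i) o in
  slab N (odd i (+) S rho (code_col k i)) (M rho (code_col k i)).

Lemma code_col_lt (k : 'I_r) (i : 'I_(2 * s)) : code_col k i < r * s.
Proof.
rewrite /code_col; have := ltn_ord k; have := ltn_ord i.
have : i./2 < s -> k < r -> k * s + i./2 < r * s by nia.
lia.
Qed.

Lemma row_of_lt h b (j : 'I_(2 * n)) : row_of h b j < (4 * n).+1.
Proof. by rewrite /row_of; have := ltn_ord j; case: (_ (+) _); lia. Qed.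

Lemma code_row_lt h o : code_row h o < (4 * n).+1.
Proof. by case: o => [[b j]|] //; apply: row_of_lt. Qed.

Lemma code_row_inj h : injective (code_row h).
Proof.
move=> [[b j]|] [[b' j']|] //=; rewrite /row_of; try lia.
move=> E.
have Ej : val j = val j' by move: E => /=; case: (_ (+) _); case: (_ (+) _); lia.
have Eb : val b = val b'.
  move: E; rewrite /= Ej; case: b b' => [[|[|//]] hb] [[|[|//]] hb'] //=; case: h; lia.
by congr (Some (_, _)); apply: val_inj.
Qed.

(** The magnitude gives row and column, then the sign gives the parity of [i]. Only with this parity
    does the row determine [o]. *)
Lemma code_label_inj : 0 < s -> injective code_label.
Proof.
move=> s_gt0; have [Mlt Minj _] := MS.
move=> [[k i] o] [[k' i'] o'] /=.
have Hc := code_col_lt k i; have Hc' := code_col_lt k' i'.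
have Hr := code_row_lt (odd i) o; have Hr' := code_row_lt (odd i') o'.
move=> /(slab_inj (Mlt _ _ Hr Hc) (Mlt _ _ Hr' Hc')) [Es Em].
have [Er Ec] := Minj _ _ _ _ Hr Hc Hr' Hc' Em.
move: Es; rewrite Er Ec => /addIb Eo.
move: Er; rewrite Eo => /code_row_inj ->.
have Hi : i./2 < s by have := ltn_ord i; lia.
have Hi' : i'./2 < s by have := ltn_ord i'; lia.
have Ek : val k = val k'.
  have := congr1 (divn^~ s) Ec; rewrite /code_col /= !divnMDl //.
  by rewrite !divn_small // !addn0.
have Ei : val i = val i'.
  move: Ec; rewrite /code_col Ek => /addnI Eh.
  by rewrite /= -(odd_double_half i) -(odd_double_half i') Eo Eh.
by congr (_, _, _); apply: val_inj.
Qed.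

Lemma code_label_lt d : code_label d < #|ecode|.
Proof.
have [Mlt _ _] := MS.
have -> : #|ecode| = 2 * N.
  by rewrite !card_prod card_option card_prod !card_ord /N; nia.
case: d => [[k i] o] /=; apply: slab_lt.
by apply: Mlt; [apply: code_row_lt | apply: code_col_lt].
Qed.

(** Complementing [2n+1] labels turns a sum [A] into [(2n+1)(2N+1) - A], which swaps the two
    equations of the table; the exchange of endpoints swaps them back. So the sum depends on [b]
    alone. *)
Lemma pvertex_sum (k : 'I_r) (i : 'I_(2 * s)) (b : 'I_2) :
  let A := \sum_(d | pvertex k i b \in edge_of d) (code_label d).+1 in
  if b == 1 :> nat then 2 * A = (2 * n + 1) * (2 * N).+1 + d0
  else 2 * A + d0 = (2 * n + 1) * (2 * N).+1.
Proof.
move=> A; have [Mlt _ Msum] := MS.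
have Hc := code_col_lt k i; have [Hu Hv] := Msum _ Hc; move: Hu Hv.
rewrite -/N {}/A sum_pvertex /=; set c := code_col k i in Hc *.
pose L rho := (slab N (S rho c) (M rho c)).+1.
pose L' rho := (slab N (~~ S rho c) (M rho c)).+1.
have flip rho : rho < (4 * n).+1 -> L' rho + L rho = (2 * N).+1.
  by move=> rho_lt; apply: slabK; apply: Mlt.
rewrite -!/(L _).
have -> : \sum_(l < n) (L (4 * l + 1) + L (4 * l + 2)) =
  \sum_(l < n) (L (row_of false 0 (2 * l)) + L (row_of false 0 (2 * l).+1)).
  by apply: eq_bigr => l _; congr (L _ + L _); rewrite /row_of /=; lia.
have -> : \sum_(l < n) (L (4 * l + 3) + L (4 * l + 4)) =
  \sum_(l < n) (L (row_of false 1 (2 * l)) + L (row_of false 1 (2 * l).+1)).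
  by apply: eq_bigr => l _; congr (L _ + L _); rewrite /row_of /=; lia.
rewrite -(sum_ord_double n (fun j => L (row_of false 0 j))).
rewrite -(sum_ord_double n (fun j => L (row_of false 1 j))) => Hu Hv.
case: (odd i) => /=; last by case: b => [[|[|//]] hb].
rewrite -/(L' _).
have flip_sum b1 : \sum_(j < 2 * n) L' (row_of false b1 j) +
    \sum_(j < 2 * n) L (row_of false b1 j) = 2 * n * (2 * N).+1.
  rewrite -big_split /= -[X in _ = X * _]card_ord -sum_nat_const.
  by apply: eq_bigr => j _; rewrite flip // row_of_lt.
have := flip 0 isT.
case: b => [[|[|//]] hb] /=.
  by have := flip_sum 1; set X := \sum_(j < 2 * n) L' _; rewrite -/X; nia.
by have := flip_sum 0; set X := \sum_(j < 2 * n) L' _; rewrite -/X; nia.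
Qed.

(** In a pair of copies, endpoint [b] of the first and endpoint [1-b] of the second use the same
    table entry with opposite signs, so each pair contributes [2(2N+1)]. *)
Lemma overtex_sum (k : 'I_r) (j : 'I_(2 * n)) :
  \sum_(d | overtex k j \in edge_of d) (code_label d).+1 = 2 * s * (2 * N).+1.
Proof.
have [Mlt _ _] := MS.
rewrite sum_overtex /=.
pose F b i := (slab N (odd i (+) S (row_of (odd i) b j) (code_col k i))
  (M (row_of (odd i) b j) (code_col k i))).+1.
rewrite (sum_ord_double s (fun i => F 0 i + F 1 i)) /F.
have -> : 2 * s * (2 * N).+1 = \sum_(l < s) 2 * (2 * N).+1.
  by rewrite sum_nat_const card_ord; lia.
apply: eq_bigr => l _.
have c_lt : k * s + l < r * s by have := ltn_ord k; have := ltn_ord l; nia.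
have El : odd (2 * l) = false by lia.
have Ec : code_col k (2 * l) = k * s + l by rewrite /code_col; lia.
have Ec' : code_col k (2 * l).+1 = k * s + l by rewrite /code_col; lia.
rewrite /= El Ec Ec' /=.
have flip b : (slab N (~~ S (row_of false b j) (k * s + l)) (M (row_of false b j) (k * s + l))).+1 +
    (slab N (S (row_of false b j) (k * s + l)) (M (row_of false b j) (k * s + l))).+1 = (2 * N).+1.
  by apply: slabK; apply: Mlt => //; apply: row_of_lt.
have := flip 0; have := flip 1; rewrite /row_of /=; lia.
Qed.

End Construction.

(** * Three colors suffice and are needed *)

Theorem theorem2p3 (n r s : nat) (hn : 1 <= n) (hr : 2 <= r) (hs : 1 <= s) :
  chi_la
    (copies r
       (join_graph (copies (2 * s) (path_graph 2)) (edgeless_graph (2 * n)))) = 3.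
Proof.
have r_gt0 : 0 < r by apply: ltnW.
have rs_gt0 : 0 < r * s by rewrite muln_gt0 r_gt0.
have [M [S [d [MS d_lt]]]] := exists_table hn rs_gt0.
have [f f_bij f_sum] := edge_labeling_of (@edge_of_inj n r s) (edge_of_im n r s)
  (code_label_inj MS hs) (code_label_lt MS).
pose G := join_copies n r s.
set W := (2 * (r * s * (4 * n).+1)).+1 in d_lt.
have sumP k i b : let A := induced_label f (pvertex n k i b) in
  if b == 1 :> nat then 2 * A = (2 * n + 1) * W + d
  else 2 * A + d = (2 * n + 1) * W.
  rewrite f_sum; exact: (pvertex_sum MS).
have sumO k j : induced_label f (overtex s k j) = 2 * s * W.
  rewrite f_sum; exact: (overtex_sum MS).
pose k0 : 'I_r := Ordinal r_gt0.
have i0P : 0 < 2 * s by rewrite muln_gt0.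
have j0P : 0 < 2 * n by rewrite muln_gt0.
pose i0 := Ordinal i0P; pose j0 := Ordinal j0P.
have d_gt0 : 0 < d.
  have := sumP k0 i0 ord0; have := sumP k0 i0 ord_max => /=; rewrite /W; lia.
(* As [0 < d < W], [2x] lies strictly between [2nW] and [(2n+2)W] and is not [(2n+1)W], whereas
   [4sW] is an even multiple of [W]. *)
have far x : (2 * x = (2 * n + 1) * W + d) \/ (2 * x + d = (2 * n + 1) * W) ->
    x != 2 * s * W.
  move=> H; apply/eqP => E; subst x.
  have [le|lt] := leqP (2 * s * 2) (2 * n).
    have : 2 * s * 2 * W <= 2 * n * W by rewrite leq_mul2r le orbT.
    lia.
  have : (2 * n + 2) * W <= 2 * s * 2 * W by rewrite leq_mul2r; apply/orP; right; lia.
  lia.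
pose p b : G := pvertex n k0 i0 b.
apply: (@chi_la_eq3 _ (p ord0) (p ord_max) (overtex s k0 j0) f).
- by rewrite /= /copies_adj /= /copies_adj /= ?eqxx.
- by rewrite /= /copies_adj /= ?eqxx.
- by rewrite /= /copies_adj /= ?eqxx.
- rewrite /local_antimagic f_bij; apply/forallP => u; apply/forallP => v.
  apply/implyP; case: u v => [k u] [k' v]; rewrite /= /copies_adj /= => /andP[_].
  case: u v => [[i b]|j] [[i' b']|j'] //=.
  + rewrite /copies_adj /= => /andP[_].
    change (path_adj b b' -> induced_label f (pvertex n k i b) !=
      induced_label f (pvertex n k' i' b')).
    have := sumP k i b; have := sumP k' i' b'.
    move: (induced_label f _) (induced_label f _) => x y.
    rewrite /path_adj; case: b b' => [[|[|//]] hb] [[|[|//]] hb'] //= *; apply/eqP; lia.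
  + move=> _; change (induced_label f (pvertex n k i b) != induced_label f (overtex s k' j')).
    rewrite sumO; apply: far.
    by have := sumP k i b => /=; case: (b == 1 :> nat); [left|right].
  + move=> _; change (induced_label f (overtex s k j) != induced_label f (pvertex n k' i' b')).
    rewrite sumO eq_sym; apply: far.
    by have := sumP k' i' b' => /=; case: (b' == 1 :> nat); [left|right].
- rewrite /num_colors.
  pose F (u : G) := induced_label f u.
  apply: (@uniq_leq_size _ _ [:: F (p ord0); F (p ord_max); F (overtex s k0 j0)]).
    exact: undup_uniq.
  move=> x; rewrite mem_undup => /imageP[[k [[i b]|j]] _ ->]; rewrite !inE.
    change ([|| F (pvertex n k i b) == F (p ord0), F (pvertex n k i b) == F (p ord_max) |
      F (pvertex n k i b) == F (overtex s k0 j0)]).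
    have := sumP k i b; have := sumP k0 i0 ord0; have := sumP k0 i0 ord_max.
    rewrite -/(p ord0) -/(p ord_max) -!/(F _) /=.
    case: (b == 1 :> nat) => *; apply/or3P; [constructor 2|constructor 1]; apply/eqP; lia.
  by apply/or3P; constructor 3; rewrite /F !sumO; apply/eqP; rewrite -(sumO k j).
Qed.
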